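(* Let $k$ be a commutative ring, let $\mathcal{D}$ be a small category with a homological modulus $\mu$ over $k$, and suppose $\mathcal{D}$ is equipped with an effective context refining $\mu$. Let $V$ be a representation of $\mathcal{D}$ over $k$ generated in degrees $\{d_1,\dots,d_l\}$. Let $X_V(f)$, $A_V(z)$, $B_V(z)$, $Y_V(f)$ be the linear maps built from $V$, $(d_1,\dots,d_l)$ and the effective context as described in the context. Then: (1) The linear maps $Y_V(f)$ depend only on the linear maps $V(g)$ where $g$ ranges over the arrows of $\mathcal{D}$ whose source and target both lie in the finite set $\mu(\{d_1,\dots,d_l\})=\bigcup_{j}\mu(d_j)$ (given the effective context and the choices of factorizations $X_V(1_z)=A_V(z)\circ B_V(z)$). (2) The assignment $f\mapsto Y_V(f)$ defines a representation $Y_V$ of $\mathcal{D}$ (whose value at an object $z$ is the target of $B_V(z)$, equivalently the source of $A_V(z)$). (3) There is an isomorphism of representations $V\simeq Y_V$.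
   Context: A representation of $\mathcal{D}$ over $k$ is a functor $V:\mathcal{D}\to\mathrm{Mod}_k$; maps are natural transformations; subrepresentations are formed objectwise. $V$ is generated in degrees $\{d_1,\dots,d_l\}$ if any subrepresentation $W\subseteq V$ with $W(d_j)=V(d_j)$ for all $j$ equals $V$. Homological modulus: for objects $x,y$, let $S(x,y)$ be the set of morphisms $x\to x$ that factor through $y$. For $d\in\mathcal{D}$ and $s\in S(x,y)$, let $M_s$ be the $0$-$1$ matrix over $k$ with rows and columns indexed by $\operatorname{Hom}_{\mathcal{D}}(d,x)$, with $(f,g)$ entry $1$ iff $s\circ f=g$. Write $x\leq_d y$ if the identity matrix is in the $k$-span of the $M_s$, $s\in S(x,y)$. A homological modulus is a function $\mu$ from objects to finite sets of objects such that for all $d,x\in\mathcal{D}$ there is $y\in\mu(d)$ with $x\leq_d y$. An effective context refining $\mu$ consists, for every pair of objects $d,x\in\mathcal{D}$, of: a natural number $\kappa$; a tuple $m=(m_1,\dots,m_\kappa)$ of objects $m_i\in\mu(d)$; a tuple $\alpha=(\alpha_1,\dots,\alpha_\kappa)$ of finitely-supported functions $\alpha_i:\operatorname{Hom}_{\mathcal{D}}(x,m_i)\to k$; and a tuple $\beta=(\beta_1,\dots,\beta_\kappa)$ of finitely-supported functions $\beta_i:\operatorname{Hom}_{\mathcal{D}}(m_i,x)\to k$; such that for every pair of arrows $f,g:d\to x$, $$\sum_{i=1}^{\kappa}\ \sum_{\substack{p:x\to m_i,\ q:m_i\to x\\ q\circ p\circ f=g}}\alpha_i(p)\beta_i(q)=\begin{cases}1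 & f=g,\\ 0& f\ne g.\end{cases}$$ Write $\kappa^{j,x},m^{j,x},\alpha^{j,x},\beta^{j,x}$ for the data associated to the pair $(d_j,x)$. Construction. Let $f:x\to y$ be an arrow of $\mathcal{D}$. For $i,j\in\{1,\dots,l\}$, define the $\kappa^{i,y}\times\kappa^{j,x}$ block matrix $T^{ij}$, whose $(r,s)$ entry is the linear map $V(m^{j,x}_s)\to V(m^{i,y}_r)$ $$T^{ij}_{rs}=\sum_{\substack{p:m^{j,x}_s\to x\\ q:y\to m^{i,y}_r}}\beta^{j,x}_s(p)\cdot\alpha^{i,y}_r(q)\cdot V(q\circ f\circ p).$$ For $1\leq i<j\leq l$, define the $\kappa^{i,x}\times\kappa^{j,x}$ block matrix $U^{ij}$ with $(r,s)$ entry $$U^{ij}_{rs}=\sum_{\substack{p:m^{j,x}_s\to x\\ q:x\to m^{i,x}_r}}\beta^{j,x}_s(p)\cdot\alpha^{i,x}_r(q)\cdot V(q\circ p).$$ The $l\times l$ block matrix $X=X_V(f)$, viewed as a linear map $\bigoplus_{j=1}^{l}\bigoplus_{s=1}^{\kappa^{j,x}}V(m^{j,x}_s)\to\bigoplus_{i=1}^{l}\bigoplus_{r=1}^{\kappa^{i,y}}V(m^{i,y}_r)$, is given by $X_{i1}=T^{i1}$ and, column by column, $$X_{ij}=T^{ij}-\sum_{n=1}^{j-1}X_{in}\circ U^{nj}.$$ For each object $z\in\mathcal{D}$, factor the linear map $X_V(1_z)$ as a surjection $B_V(z)$ followed by an injection $A_V(z)$, so $X_V(1_z)=A_V(z)\circ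 B_V(z)$. Finally, for $f:x\to y$ define $$Y_V(f)=B_V(y)\circ X_V(f)\circ A_V(x).$$ *)

(* Defs.v *)
From HB Require Import structures.
From mathcomp Require Import all_boot all_order all_algebra.
From mathcomp Require Import finmap.

Set Implicit Arguments.
Unset Strict Implicit.
Unset Printing Implicit Defensive.

Import GRing.Theory.
Local Open Scope ring_scope.

(* Sets are choiceTypes throughout, so that {fset _} and {fsfun _} make sense
   on objects and on morphisms. *)
Record category := Category {
  obj :> choiceType;
  mor : obj -> obj -> choiceType;
  mid : forall x, mor x x;
  mcomp : forall x y z, mor y z -> mor x y -> mor x z;
  mcomp1m : forall x y (f : mor x y), mcomp (mid y) f = f;
  mcompm1 : forall x y (f : mor x y), mcomp f (mid x) = f;
  mcompmA : forall x y z w (h : mor z w) (g : mor y z) (f : mor x y),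
    mcomp h (mcomp g f) = mcomp (mcomp h g) f }.

Arguments mor {c}.
Arguments mid {c}.
Arguments mcomp {c x y z}.

Notation "g '\oc' f" := (mcomp g f) (at level 50, left associativity).

Section FullSubcategory.
Variables (D : category) (S : {fset D}).

Let sobj : choiceType := {x : D | x \in S}.
Let shom (x y : sobj) : choiceType := mor (val x) (val y).

Definition full_subcat : category :=
  @Category sobj shom (fun x => mid (val x))
    (fun x y z (g : shom y z) (f : shom x y) => g \oc f)
    (fun x y (f : shom x y) => mcomp1m f) (fun x y (f : shom x y) => mcompm1 f)
    (fun x y z w (h : shom z w) (g : shom y z) (f : shom x y) => mcompmA h g f).

End FullSubcategory.

Section Representations.
Variable k : comPzRingType.

Section Functors.
Variable D : category.

Definition functorial (M : D -> lmodType k)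
    (F : forall x y, mor x y -> {linear M x -> M y}) : Prop :=
  (forall x v, F x x (mid x) v = v) /\
  (forall x y z (g : mor y z) (f : mor x y) v,
     F x z (g \oc f) v = F y z g (F x y f v)).

Record rep := Rep {
  rep_obj :> D -> lmodType k;
  rep_map : forall x y, mor x y -> {linear rep_obj x -> rep_obj y};
  rep_functorial : functorial rep_map }.

Record rep_hom (V W : rep) := RepHom {
  rep_hom_fun :> forall x, {linear V x -> W x};
  rep_hom_natural : forall x y (f : mor x y) v,
    rep_hom_fun y (rep_map V f v) = rep_map W f (rep_hom_fun x v) }.

Definition rep_iso (V W : rep) : Prop :=
  exists (phi : rep_hom V W) (psi : rep_hom W V),
    forall x, cancel (phi x) (psi x) /\ cancel (psi x) (phi x).

(* Submodules are boolean predicates, as for submod_closed in ssralg; with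
   excluded middle every submodule is of this form. *)
Definition subrep (V : rep) (W : forall x, {pred V x}) : Prop :=
  (forall x, submod_closed (W x)) /\
  (forall x y (f : mor x y) v, v \in W x -> rep_map V f v \in W y).

Definition generated_in_degrees (V : rep) (l : nat) (d : 'I_l -> D) : Prop :=
  forall W : forall x, {pred V x}, subrep W ->
    (forall j v, v \in W (d j)) -> forall x v, v \in W x.

End Functors.

Section Restriction.
Variables (D : category) (S : {fset D}) (V : rep D).

Lemma restrict_functorial :
  @functorial (full_subcat S) (fun x => V (val x))
    (fun x y f => @rep_map D V (val x) (val y) f).
Proof.
by case: (rep_functorial V) => V1 VM; split=> *; [apply: V1 | apply: VM].
Qed.

Definition restrict : rep (full_subcat S) := Rep restrict_functorial.

End Restriction.

Section HomologicalModulus.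
Variable D : category.

Definition factors_through (x y : D) (s : mor x x) : Prop :=
  exists (p : mor x y) (q : mor y x), s = q \oc p.

Definition post_matrix (d x : D) (s : mor x x) (f g : mor d x) : k :=
  (s \oc f == g)%:R.

(* x <=_d y *)
Definition hom_le (d x y : D) : Prop :=
  exists (n : nat) (s : 'I_n -> mor x x) (c : 'I_n -> k),
    (forall i, factors_through y (s i)) /\
    (forall f g : mor d x, \sum_(i < n) c i * post_matrix (s i) f g = (f == g)%:R).

Definition homological_modulus (mu : D -> {fset D}) : Prop :=
  forall d x : D, exists2 y, y \in mu d & hom_le d x y.

(* The sums over all p and q are over the supports of alpha_i and beta_i;
   the other terms are zero. *)
Record effective_context (mu : D -> {fset D}) := EffectiveContext {
  ec_kappa : D -> D -> nat;
  ec_m : forall d x, 'I_(ec_kappa d x) -> D;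
  ec_m_mu : forall d x i, @ec_m d x i \in mu d;
  ec_alpha : forall d x (i : 'I_(ec_kappa d x)),
    {fsfun mor x (ec_m i) -> k with 0};
  ec_beta : forall d x (i : 'I_(ec_kappa d x)),
    {fsfun mor (ec_m i) x -> k with 0};
  ec_identity : forall d x (f g : mor d x),
    \sum_(i < ec_kappa d x)
      \sum_(p <- finsupp (@ec_alpha d x i))
        \sum_(q <- finsupp (@ec_beta d x i) | q \oc p \oc f == g)
          ec_alpha i p * ec_beta i q = (f == g)%:R }.

End HomologicalModulus.

Section DirectSum.
Variables (I : finType) (M : I -> lmodType k).

Definition dsum : Type := {dffun forall i, M i}.

HB.instance Definition _ := Choice.on dsum.

Implicit Types u v w : dsum.

Definition dsum_zero : dsum := [ffun i => 0 : M i].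
Definition dsum_opp u : dsum := [ffun i => - u i].
Definition dsum_add u v : dsum := [ffun i => u i + v i].
Definition dsum_scale (a : k) u : dsum := [ffun i => a *: u i].

Fact dsum_addA : associative dsum_add.
Proof. by move=> u v w; apply/ffunP=> i; rewrite !ffunE addrA. Qed.
Fact dsum_addC : commutative dsum_add.
Proof. by move=> u v; apply/ffunP=> i; rewrite !ffunE addrC. Qed.
Fact dsum_add0 : left_id dsum_zero dsum_add.
Proof. by move=> u; apply/ffunP=> i; rewrite !ffunE add0r. Qed.
Fact dsum_addN : left_inverse dsum_zero dsum_opp dsum_add.
Proof. by move=> u; apply/ffunP=> i; rewrite !ffunE addNr. Qed.

HB.instance Definition _ :=
  GRing.isZmodule.Build dsum dsum_addA dsum_addC dsum_add0 dsum_addN.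

Fact dsum_scaleA a b v : dsum_scale a (dsum_scale b v) = dsum_scale (a * b) v.
Proof. by apply/ffunP=> i; rewrite !ffunE scalerA. Qed.
Fact dsum_scale1 : left_id 1 dsum_scale.
Proof. by move=> u; apply/ffunP=> i; rewrite !ffunE scale1r. Qed.
Fact dsum_scaleDr : right_distributive dsum_scale +%R.
Proof. by move=> a u v; apply/ffunP=> i; rewrite !ffunE scalerDr. Qed.
Fact dsum_scaleDl v : {morph dsum_scale^~ v : a b / a + b}.
Proof. by move=> a b; apply/ffunP=> i; rewrite !ffunE scalerDl. Qed.

HB.instance Definition _ := GRing.Zmodule_isLmodule.Build k dsum
  dsum_scaleA dsum_scale1 dsum_scaleDr dsum_scaleDl.

End DirectSum.

Section Construction.
Variables (D : category) (mu : D -> {fset D}) (E : effective_context mu).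
Variables (l : nat) (d : 'I_l -> D).

(* A slot (j, s) at z indexes the summand V(m_s^{j,z}). *)
Definition slot (z : D) : finType := {j : 'I_l & 'I_(ec_kappa E (d j) z)}.

Definition slot_obj z (a : slot z) : D := ec_m (tagged a).
Definition slot_alpha z (a : slot z) : {fsfun mor z (slot_obj a) -> k with 0} :=
  ec_alpha (tagged a).
Definition slot_beta z (a : slot z) : {fsfun mor (slot_obj a) z -> k with 0} :=
  ec_beta (tagged a).

Definition mu_degrees : {fset D} := (\bigcup_(j <- enum 'I_l) mu (d j))%fset.

Fact slot_obj_mu z (a : slot z) : slot_obj a \in mu_degrees.
Proof.
apply/bigfcupP; exists (tag a); last exact: ec_m_mu.
by rewrite mem_enum.
Qed.

Definition slot_sub z (a : slot z) : full_subcat mu_degrees :=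
  exist _ (slot_obj a) (slot_obj_mu a).

Definition slot_space (V : rep D) (z : D) : lmodType k :=
  dsum (fun a : slot z => V (slot_obj a)).

(* The same module, formed from a representation of the full subcategory on
   mu_degrees only: slot_space V z is convertible to
   slot_space_sub (restrict mu_degrees V) z. *)
Definition slot_space_sub (W : rep (full_subcat mu_degrees)) (z : D) :
    lmodType k :=
  dsum (fun a : slot z => W (slot_sub a)).

Variable V : rep D.

(* With a = (j, s) and b = (i, r), T_entry f b a is T^{ij}_{rs}. *)
Definition T_entry x y (f : mor x y) (b : slot y) (a : slot x)
    (v : V (slot_obj a)) : V (slot_obj b) :=
  \sum_(p <- finsupp (slot_beta a)) \sum_(q <- finsupp (slot_alpha b))
    (slot_beta a p * slot_alpha b q) *: rep_map V (q \oc f \oc p) v.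

Definition U_entry x (b a : slot x) (v : V (slot_obj a)) : V (slot_obj b) :=
  \sum_(p <- finsupp (slot_beta a)) \sum_(q <- finsupp (slot_alpha b))
    (slot_beta a p * slot_alpha b q) *: rep_map V (q \oc p) v.

(* Recursion on the column index j = tag a; any fuel n >= j gives the same
   value, see X_entryE. *)
Fixpoint X_col (n : nat) x y (f : mor x y) (b : slot y) (a : slot x)
    (v : V (slot_obj a)) : V (slot_obj b) :=
  T_entry f b v -
  if n is n'.+1 then
    \sum_(c : slot x | (tag c < tag a)%N) X_col n' f b (U_entry c v)
  else 0.

Definition X_entry x y (f : mor x y) (b : slot y) (a : slot x) :
    V (slot_obj a) -> V (slot_obj b) :=
  @X_col (tag a) x y f b a.

Lemma X_col_fuel n m x y (f : mor x y) (b : slot y) (a : slot x) v :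
  (tag a <= n)%N -> (tag a <= m)%N -> X_col n f b v = @X_col m x y f b a v.
Proof.
have stable n1 n2 (a1 : slot x) (v1 : V (slot_obj a1)) :
    (tag a1 <= n1)%N -> (n1 <= n2)%N -> X_col n1 f b v1 = X_col n2 f b v1.
  elim: n1 n2 a1 v1 => [|n1 IH] [|n2] a1 v1 //= a1n n12; congr (_ - _).
    by rewrite big1 // => c; rewrite ltnNge (leq_trans a1n).
  by apply: eq_bigr => c ca1; apply: IH => //; rewrite -ltnS (leq_trans ca1).
by move=> an am; case: (leqP n m) => [|/ltnW] nm; [|symmetry]; apply: stable.
Qed.

Lemma X_entryE x y (f : mor x y) (b : slot y) (a : slot x) v :
  X_entry f b v =
  T_entry f b v -
  \sum_(c : slot x | (tag c < tag a)%N) X_entry f b (@U_entry x c a v).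
Proof.
rewrite /X_entry; case def_n: (nat_of_ord (tag a)) => [|n] /=; congr (_ - _).
  by rewrite big1.
by apply: eq_big => c; rewrite def_n // => cn; apply: X_col_fuel.
Qed.

Definition X_fun x y (f : mor x y) (v : slot_space V x) : slot_space V y :=
  [ffun b => \sum_(a : slot x) X_entry f b (v a)].

Fact T_entry_linear x y (f : mor x y) b a : linear (@T_entry x y f b a).
Proof.
move=> e u v; rewrite /T_entry scaler_sumr -big_split; apply: eq_bigr => p _ /=.
rewrite scaler_sumr -big_split; apply: eq_bigr => q _ /=.
by rewrite linearP scalerDr !scalerA mulrC.
Qed.

Fact U_entry_linear x b a : linear (@U_entry x b a).
Proof.
move=> e u v; rewrite /U_entry scaler_sumr -big_split; apply: eq_bigr => p _ /=.
rewrite scaler_sumr -big_split; apply: eq_bigr => q _ /=.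
by rewrite linearP scalerDr !scalerA mulrC.
Qed.

Fact X_col_linear n x y (f : mor x y) b a : linear (@X_col n x y f b a).
Proof.
elim: n a => [|n IH] a e u v /=; rewrite T_entry_linear; first by rewrite !subr0.
rewrite scalerBr addrACA -opprD; congr (_ - _).
rewrite scaler_sumr -big_split; apply: eq_bigr => c _ /=.
by rewrite U_entry_linear IH.
Qed.

Fact X_fun_linear x y (f : mor x y) : linear (X_fun f).
Proof.
move=> e u v; apply/ffunP=> b; rewrite !ffunE scaler_sumr -big_split.
by apply: eq_bigr => a _ /=; rewrite !ffunE; apply: X_col_linear.
Qed.

HB.instance Definition _ x y (f : mor x y) :=
  GRing.isLinear.Build k (slot_space V x) (slot_space V y) _ (X_fun f)
    (X_fun_linear f).

Definition X_map x y (f : mor x y) : {linear slot_space V x -> slot_space V y} :=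
  X_fun f.

Record factorization := Factorization {
  fac_obj : D -> lmodType k;
  fac_B : forall z, {linear slot_space V z -> fac_obj z};
  fac_A : forall z, {linear fac_obj z -> slot_space V z};
  fac_B_surj : forall z w, exists v, fac_B z v = w;
  fac_A_inj : forall z, injective (fac_A z);
  fac_AB : forall z v, X_map (mid z) v = fac_A z (fac_B z v) }.

Variable F : factorization.

Definition Y_map x y (f : mor x y) : {linear fac_obj F x -> fac_obj F y} :=
  fac_B F y \o X_map f \o fac_A F x.

End Construction.

End Representations.

(* Main.v *)
Require Import Defs.
From HB Require Import structures.
From mathcomp Require Import all_boot all_order all_algebra.
From mathcomp Require Import finmap.
From mathcomp Require Import boolp.

(** Write [beta_a] and [alpha_a] for the actions of [slot_beta a] and
    [slot_alpha a] on [V], extended linearly from morphisms to their formal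
    combinations: [beta_a] maps the summand of the slot [a] into [V x], and
    [alpha_a] maps [V x] back.  Put [e_n = sum beta_a alpha_a], over the slots
    [a] of degree index [n]; it is an endomorphism of [V x] ([degree_endo]).
    The identity imposed on an effective context says that [e_n] fixes every
    element [V(g) v] with [g : d_n -> x] ([degree_endo_image]).

    Let [P_n = (1 - e_0) ... (1 - e_{n-1})] ([residue]).  As [e_n] is a
    combination of maps [V(s)] with [s : x -> x], it carries the image of
    [V(g)], [g : d_j -> x], into sums of such images, and the factor [1 - e_j]
    kills them all; hence [P_n] vanishes on what [V(d_j)] generates as soon as
    [j < n] ([residue_image]).  Because [V] is generated in degrees
    [d_0, ..., d_{l-1}], [P_l = 0] ([residue_full]).

    The recursion defining [X] expands exactly this product: the entry of
    [X_V(f)] in the row of [b] and the column of [a], where [a] has degree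
    index [n], is [alpha_b V(f) P_n beta_a] ([X_entry_factor]).  So [X_V(f)]
    factors as [embed V(f) retract], where [embed] collects the [alpha_b] and
    [retract] is the sum of the [P_n beta_a].  The products telescope,
    [sum_n P_n e_n = sum_n (P_n - P_{n+1}) = 1 - P_l = 1], which says that
    [embed] is a section of [retract] ([embedK]).  In particular
    [X_V(1_z) = embed retract] is a second factorization of [X_V(1_z)] as an
    injection after a surjection, and comparing it with the chosen one gives
    an isomorphism from [V z] to the middle module which carries [V(f)] to
    [Y_V(f)] ([Y_mapE], [Y_map_iso]).

    That [Y_V] depends only on the restriction of [V] holds because every
    morphism on which the construction evaluates [V] runs between slots, so the
    construction can be carried out on a representation of the full subcategory
    ([Y_map_restrict]). *)

Set Implicit Arguments.
Unset Strict Implicit.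
Unset Printing Implicit Defensive.

Import GRing.Theory.
Local Open Scope ring_scope.

(** * Linearity of sums of maps *)

Section LinearCombinations.
Variables (k : comPzRingType) (U M : lmodType k).

Lemma linear_sum_fun (I : Type) (r : seq I) (Q : pred I) (g : I -> U -> M) :
  (forall i, linear (g i)) -> linear (fun v => \sum_(i <- r | Q i) g i v).
Proof.
move=> gL e u v; rewrite scaler_sumr -big_split.
by apply: eq_bigr => i _; apply: gL.
Qed.

Lemma linear_scale_fun (c : k) (g : {linear U -> M}) :
  linear (fun v => c *: g v).
Proof. by move=> e u v; rewrite linearP scalerDr !scalerA mulrC. Qed.

Lemma linear_sub_fun (g h : U -> M) :
  linear g -> linear h -> linear (fun v => g v - h v).
Proof.
by move=> gL hL e u v; rewrite gL hL scalerBr opprD addrACA.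
Qed.

End LinearCombinations.

(** * The construction over the full subcategory *)

Section RestrictedConstruction.
Variables (k : comPzRingType) (D : category) (mu : D -> {fset D}).
Variables (E : effective_context k mu) (l : nat) (d : 'I_l -> D).
Variable W : rep k (full_subcat (mu_degrees mu d)).

Local Notation slot := (slot E d).
Local Notation space := (slot_space_sub E W).
(* The type constraint lets a morphism of D between two slots be read as a
   morphism of the full subcategory, on which W is defined. *)
Local Notation smor a b := (@mor (full_subcat _) (slot_sub a) (slot_sub b)).

Definition T_entry_sub x y (f : mor x y) (b : slot y) (a : slot x)
    (v : W (slot_sub a)) : W (slot_sub b) :=
  \sum_(p <- finsupp (slot_beta a)) \sum_(q <- finsupp (slot_alpha b))
    (slot_beta a p * slot_alpha b q) *: rep_map W (q \oc f \oc p : smor a b) v.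

Definition U_entry_sub x (b a : slot x) (v : W (slot_sub a)) : W (slot_sub b) :=
  \sum_(p <- finsupp (slot_beta a)) \sum_(q <- finsupp (slot_alpha b))
    (slot_beta a p * slot_alpha b q) *: rep_map W (q \oc p : smor a b) v.

Fixpoint X_col_sub (n : nat) x y (f : mor x y) (b : slot y) (a : slot x)
    (v : W (slot_sub a)) : W (slot_sub b) :=
  T_entry_sub f b v -
  if n is n'.+1 then
    \sum_(c : slot x | (tag c < tag a)%N) X_col_sub n' f b (U_entry_sub c v)
  else 0.

Definition X_fun_sub x y (f : mor x y) (v : space x) : space y :=
  [ffun b => \sum_(a : slot x) X_col_sub (tag a) f b (v a)].

Lemma T_entry_sub_linear x y (f : mor x y) b a :
  linear (@T_entry_sub x y f b a).
Proof. by do 2![apply: linear_sum_fun => ?]; apply: linear_scale_fun. Qed.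

Lemma U_entry_sub_linear x b a : linear (@U_entry_sub x b a).
Proof. by do 2![apply: linear_sum_fun => ?]; apply: linear_scale_fun. Qed.

Lemma X_col_sub_linear n x y (f : mor x y) b a :
  linear (@X_col_sub n x y f b a).
Proof.
elim: n a => [|n IH] a; apply: linear_sub_fun; try exact: T_entry_sub_linear.
  by move=> e u v; rewrite scaler0 addr0.
by apply: linear_sum_fun => c e u v; rewrite U_entry_sub_linear; apply: IH.
Qed.

Lemma X_fun_sub_linear x y (f : mor x y) : linear (X_fun_sub f).
Proof.
move=> e u v; apply/ffunP=> b; rewrite !ffunE scaler_sumr -big_split.
by apply: eq_bigr => a _ /=; rewrite !ffunE; apply: X_col_sub_linear.
Qed.

HB.instance Definition _ x y (f : mor x y) :=
  GRing.isLinear.Build k (space x) (space y) _ (X_fun_sub f)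
    (X_fun_sub_linear f).

Definition Y_map_sub (I : D -> lmodType k)
    (B : forall z, {linear space z -> I z})
    (A : forall z, {linear I z -> space z}) x y (f : mor x y) :
    {linear I x -> I y} :=
  B y \o (X_fun_sub f : {linear space x -> space y}) \o A x.

End RestrictedConstruction.

(** The full subcategory inherits its morphisms and composition from [D], and
    the restriction of [V] is [V] itself on them; the two constructions
    therefore agree by computation. *)
Lemma Y_map_restrict (k : comPzRingType) (D : category) (mu : D -> {fset D})
    (E : effective_context k mu) (l : nat) (d : 'I_l -> D) (V : rep k D)
    (F : factorization E d V) x y (f : mor x y) (u : fac_obj F x) :
  Y_map F f u =
  Y_map_sub (W := restrict (mu_degrees mu d) V) (fac_B F) (fac_A F) f u.
Proof. by []. Qed.

(** * Formal combinations of morphisms acting on a representation *)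

Section Action.
Variables (k : comPzRingType) (D : category) (V : rep k D).

Definition act x y (c : {fsfun mor x y -> k with 0}) (v : V x) : V y :=
  \sum_(p <- finsupp c) c p *: rep_map V p v.

Fact act_linear x y c : linear (@act x y c).
Proof. by apply: linear_sum_fun => p; apply: linear_scale_fun. Qed.

HB.instance Definition _ x y (c : {fsfun mor x y -> k with 0}) :=
  GRing.isLinear.Build k (V x) (V y) _ (act c) (act_linear c).

Lemma rep_map1 x v : rep_map V (mid x) v = v.
Proof. by case: (rep_functorial V). Qed.

Lemma rep_mapM x y z (g : mor y z) (f : mor x y) v :
  rep_map V (g \oc f) v = rep_map V g (rep_map V f v).
Proof. by case: (rep_functorial V). Qed.

Lemma act_map_act x y z w (c : {fsfun mor z w -> k with 0}) (f : mor y z)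
    (b : {fsfun mor x y -> k with 0}) v :
  \sum_(p <- finsupp b) \sum_(q <- finsupp c)
    (b p * c q) *: rep_map V (q \oc f \oc p) v = act c (rep_map V f (act b v)).
Proof.
rewrite exchange_big; apply: eq_bigr => q _ /=.
rewrite [act b v]/act !linear_sum; apply: eq_bigr => p _ /=.
by rewrite !rep_mapM !linearZ /= scalerA.
Qed.

End Action.

(** * The identity of an effective context *)

Section EffectiveContext.
Variables (k : comPzRingType) (D : category) (mu : D -> {fset D}).
Variable E : effective_context k mu.

(** An effective context prescribes the coefficient of each [g] in the formal
    combination of the composites [q \oc p \oc f]: this combination is [f].
    Any function [G] on morphisms extends linearly to such combinations, which
    turns the family of scalar identities into one identity in [M]. *)
Lemma ec_identity_fun (M : lmodType k) (d x : D) (G : mor d x -> M) f :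
  \sum_(i < ec_kappa E d x)
    \sum_(p <- finsupp (ec_alpha i)) \sum_(q <- finsupp (ec_beta i))
      (ec_alpha i p * ec_beta i q) *: G (q \oc p \oc f) = G f.
Proof.
(* Only finitely many morphisms occur, so the coefficients can be grouped by
   the value of the composite along the list of these values. *)
pose L := undup (f ::
  flatten [seq
    flatten [seq [seq q \oc p \oc f | q <- finsupp (ec_beta i)]
      | p <- finsupp (ec_alpha i)]
    | i <- enum 'I_(ec_kappa E d x)]).
have expand h : h \in L -> G h = \sum_(h' <- L) (h == h')%:R *: G h'.
  move=> hL; rewrite (bigD1_seq h) ?undup_uniq //= eqxx scale1r.
  by rewrite big1 ?addr0 // => h'; rewrite eq_sym => /negPf->; rewrite scale0r.
rewrite [RHS]expand; last by rewrite mem_undup mem_head.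
under [RHS]eq_bigr => h _ do rewrite -(ec_identity E) scaler_suml.
rewrite [RHS]exchange_big; apply: eq_bigr => i _ /=.
under [RHS]eq_bigr => h _ do rewrite scaler_suml.
rewrite [RHS]exchange_big; apply: eq_big_seq => p pS /=.
under [RHS]eq_bigr => h _ do rewrite big_mkcond scaler_suml.
rewrite [RHS]exchange_big; apply: eq_big_seq => q qS /=.
rewrite [G _]expand ?scaler_sumr.
  by apply: eq_bigr => h _; case: eqP => _; rewrite ?scale1r // !scale0r scaler0.
rewrite mem_undup inE; apply/orP; right.
apply/flatten_mapP; exists i; first by rewrite mem_enum.
apply/flatten_mapP; exists p => //.
by apply/mapP; exists q.
Qed.

End EffectiveContext.

(** * Splitting the representation off the slot spaces *)

Section Splitting.
Variables (k : comPzRingType) (D : category) (mu : D -> {fset D}).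
Variables (E : effective_context k mu) (l : nat) (d : 'I_l -> D).
Variable V : rep k D.

Local Notation slot := (slot E d).
Local Notation space := (slot_space E d V).

Definition slot_endo x (a : slot x) (v : V x) : V x :=
  act (slot_beta a) (act (slot_alpha a) v).

(** [n] ranges over all naturals and not over ['I_l], so that [residue] is an
    ordinary recursion; beyond [l] the sum is empty. *)
Definition degree_endo x n (v : V x) : V x :=
  \sum_(a : slot x | tag a == n :> nat) slot_endo a v.

(** The product [(1 - e_0) ... (1 - e_{n-1})], whose rightmost factor acts
    first. *)
Fixpoint residue x n (v : V x) : V x :=
  if n is n'.+1 then residue n' (v - degree_endo n' v) else v.

Lemma slot_endo_linear x a : linear (@slot_endo x a).
Proof. by move=> e u v; rewrite /slot_endo !linearP. Qed.

Lemma degree_endo_linear x n : linear (@degree_endo x n).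
Proof. by apply: linear_sum_fun => a; apply: slot_endo_linear. Qed.

Lemma residue_linear x n : linear (@residue x n).
Proof.
elim: n => [|n IH] e u v //=; rewrite -IH; congr residue.
by apply: linear_sub_fun => //; apply: degree_endo_linear.
Qed.

HB.instance Definition _ x n :=
  GRing.isLinear.Build k (V x) (V x) _ (@residue x n) (@residue_linear x n).

(** The terms of degree [m] add up to [P_m e_m = P_m - P_{m+1}], and the sum
    telescopes.  It is used with [n] a column index, to solve the recursion of
    [X], and with [n = l], to split [embed]. *)
Lemma sum_residue_slot_endo x n (u : V x) :
  \sum_(a : slot x | (tag a < n)%N) residue (tag a) (slot_endo a u) =
  u - residue n u.
Proof.
elim: n => [|n IH]; first by rewrite big1 //= subrr.
rewrite (bigID (fun a : slot x => (tag a < n)%N)) /=.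
have -> : residue n (u - degree_endo n u) =
    residue n u - residue n (degree_endo n u).
  by rewrite linearB.
rewrite opprB addrA [u + _]addrC -addrA -IH [RHS]addrC; congr (_ + _).
  apply: eq_bigl => a; case: (ltnP (tag a) n) => an; rewrite ?andbF ?andbT //.
  exact: ltnW.
have slotE (a : slot x) :
    (tag a < n.+1)%N && ~~ (tag a < n)%N = (tag a == n :> nat).
  by rewrite -leqNgt ltnS -eqn_leq.
by rewrite linear_sum; apply: eq_big => [//|a]; rewrite slotE => /eqP ->.
Qed.

Lemma slot_endo_image x y (f : mor y x) (a : slot x) v :
  slot_endo a (rep_map V f v) =
  \sum_(p <- finsupp (slot_alpha a)) \sum_(q <- finsupp (slot_beta a))
    (slot_alpha a p * slot_beta a q) *: rep_map V (q \oc p \oc f) v.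
Proof.
rewrite /slot_endo -(rep_map1 (act (slot_alpha a) _)) -act_map_act.
apply: eq_bigr => p _; apply: eq_bigr => q _.
by rewrite mcompm1 -rep_mapM.
Qed.

(** For a morphism out of [d j], this is the identity of the effective context
    for the pair [(d j, x)], extended to the function sending [h] to
    [V(h) v]. *)
Lemma degree_endo_image x (j : 'I_l) (f : mor (d j) x) v :
  degree_endo j (rep_map V f v) = rep_map V f v.
Proof.
have -> u : degree_endo j u = \sum_(i < l | i == j)
    \sum_(s < ec_kappa E (d i) x) slot_endo (Tagged _ s : slot x) u.
  rewrite sig_big_dep; apply: eq_big => [a|[i s] //].
  by rewrite andbT.
rewrite big_pred1_eq -[RHS](ec_identity_fun E (fun h => rep_map V h v)).
by apply: eq_bigr => s _; rewrite slot_endo_image.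
Qed.

(** The last factor either is [1 - e_j], which kills the image, or changes the
    element by a combination of elements [V(q p f) v] of the same kind, which
    the remaining factors kill by induction. *)
Lemma residue_image x n (j : 'I_l) (f : mor (d j) x) v :
  (j < n)%N -> residue n (rep_map V f v) = 0.
Proof.
elim: n f => // n IH f /=; rewrite ltnS leq_eqVlt => /orP[/eqP <-|jn].
  by rewrite degree_endo_image subrr linear0.
rewrite linearB /= IH // sub0r linear_sum big1 ?oppr0 // => a _.
rewrite slot_endo_image linear_sum big1 // => p _.
rewrite linear_sum big1 // => q _.
by rewrite linearZ /= IH ?scaler0.
Qed.

Hypothesis genV : generated_in_degrees V d.

Lemma residue_full x (v : V x) : residue l v = 0.
Proof.
(* The kernel of the residue need not be stable under D, so generation is
   applied to the largest subrepresentation contained in it. *)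
pose W y : {pred V y} :=
  fun u => `[< forall z (g : mor y z), residue l (rep_map V g u) = 0 >].
have WP y u : reflect (forall z (g : mor y z), residue l (rep_map V g u) = 0)
    (u \in W y) by apply: asboolP.
suff /WP/(_ x (mid x)) : v \in W x by rewrite rep_map1.
apply: (genV (W := W)) => [|j w]; last first.
  by apply/WP => z g; apply: residue_image.
split=> [y|y z f w /WP Ww]; last by apply/WP => t g; rewrite -rep_mapM.
split=> [|e u w /WP Wu /WP Ww]; apply/WP => z g; first by rewrite !linear0.
by rewrite !linearP /= Wu Ww scaler0 addr0.
Qed.

Definition embed x (v : V x) : space x :=
  [ffun a => act (slot_alpha a) v].

Definition retract x (v : space x) : V x :=
  \sum_(a : slot x) residue (tag a) (act (slot_beta a) (v a)).

Lemma embed_linear x : linear (@embed x).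
Proof. by move=> e u v; apply/ffunP=> a; rewrite !ffunE linearP. Qed.

Lemma retract_linear x : linear (@retract x).
Proof. by apply: linear_sum_fun => a e u v; rewrite !ffunE !linearP. Qed.

HB.instance Definition _ x :=
  GRing.isLinear.Build k (V x) (space x) _ (@embed x) (@embed_linear x).

HB.instance Definition _ x :=
  GRing.isLinear.Build k (space x) (V x) _ (@retract x) (@retract_linear x).

(** By induction on the column, the terms subtracted in the recursion are
    [alpha_b V(f) P_m beta_c alpha_c beta_a v], for [c] of degree index
    [m < n], with [n] that of [a]; they telescope and leave
    [alpha_b V(f) P_n beta_a v]. *)
Lemma X_entry_factor x y (f : mor x y) (b : slot y) (a : slot x) v :
  X_entry (V := V) f b v =
  act (slot_alpha b) (rep_map V f (residue (tag a) (act (slot_beta a) v))).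
Proof.
have [n] := ubnP (tag a); elim: n a v => // n IH a v an.
rewrite X_entryE /T_entry act_map_act; set w := act (slot_beta a) v.
have -> : residue (tag a) w =
    w - \sum_(c : slot x | (tag c < tag a)%N) residue (tag c) (slot_endo c w).
  by rewrite sum_residue_slot_endo opprB addrC subrK.
rewrite 2!linearB; congr (_ - _).
rewrite 2!linear_sum; apply: eq_bigr => c ca.
rewrite IH ?(leq_trans ca) //; congr (act _ (rep_map V f (residue _ (act _ _)))).
rewrite /U_entry -[w]rep_map1 -act_map_act.
by do 2![apply: eq_bigr => ? _]; rewrite mcompm1.
Qed.

Lemma X_factor x y (f : mor x y) (v : space x) :
  X_map E d V f v = embed (rep_map V f (retract v)).
Proof.
apply/ffunP=> b; rewrite !ffunE !linear_sum; apply: eq_bigr => a _.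
exact: X_entry_factor.
Qed.

Lemma embedK x : cancel (@embed x) (@retract x).
Proof.
move=> v; have := sum_residue_slot_endo l v; rewrite residue_full subr0.
move=> {2}<-.
by apply: eq_big => [a|a _]; [rewrite ltn_ord | rewrite ffunE].
Qed.

Variable F : factorization E d V.

(* As A B = embed retract with A and embed injective, B and retract surjective,
   the only map compatible with both factorizations is B embed. *)
Let theta x : {linear V x -> fac_obj F x} := fac_B F x \o @embed x.
Let theta_inv x : {linear fac_obj F x -> V x} := @retract x \o fac_A F x.

(** [X_V(1_x)] is idempotent, being [embed] after [retract]; cancelling the
    injection and the surjection in [A B A B = A B] gives [B A = 1]. *)
Lemma fac_AK x : cancel (fac_A F x) (fac_B F x).
Proof.
move=> u; have [v <-] := fac_B_surj u; apply: (@fac_A_inj _ _ _ _ _ _ _ F x).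
by rewrite -!(fac_AB F) !X_factor !rep_map1 embedK.
Qed.

Lemma thetaK x : cancel (theta x) (theta_inv x).
Proof. by move=> v; rewrite /= -(fac_AB F) X_factor rep_map1 !embedK. Qed.

Lemma theta_invK x : cancel (theta_inv x) (theta x).
Proof.
move=> u; rewrite /= -[in LHS](rep_map1 (retract _)) -X_factor.
by rewrite (fac_AB F) !fac_AK.
Qed.

Lemma Y_mapE x y (f : mor x y) u :
  Y_map F f u = theta y (rep_map V f (theta_inv x u)).
Proof. by rewrite /Y_map /= -X_factor. Qed.

Lemma Y_map_iso :
  exists Y_rep : functorial (@Y_map k D mu E l d V F), rep_iso V (Rep Y_rep).
Proof.
have Yf : functorial (@Y_map k D mu E l d V F).
  split=> [x u|x y z g f u]; rewrite !Y_mapE.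
    by rewrite rep_map1 theta_invK.
  by rewrite thetaK rep_mapM.
exists Yf.
have nat x y (f : mor x y) v :
    theta y (rep_map V f v) = rep_map (Rep Yf) f (theta x v).
  by rewrite -{1}[v]thetaK -Y_mapE.
have nat_inv x y (f : mor x y) u :
    theta_inv y (rep_map (Rep Yf) f u) = rep_map V f (theta_inv x u).
  by rewrite -[RHS]thetaK -Y_mapE.
exists (RepHom (W := Rep Yf) nat), (RepHom (V := Rep Yf) nat_inv) => x.
by split; [apply: thetaK | apply: theta_invK].
Qed.

End Splitting.

Theorem theorem1p16 (k : comPzRingType) (D : category) (mu : D -> {fset D})
    (hmu : homological_modulus k mu) (E : effective_context k mu)
    (l : nat) (d : 'I_l -> D) :
  (exists Phi : forall (W : rep k (full_subcat (mu_degrees mu d)))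
                       (I : D -> lmodType k)
                       (B : forall z, {linear slot_space_sub E W z -> I z})
                       (A : forall z, {linear I z -> slot_space_sub E W z})
                       (x y : D), mor x y -> {linear I x -> I y},
     forall V : rep k D, generated_in_degrees V d ->
     forall (F : factorization E d V) (x y : D) (f : mor x y)
            (u : fac_obj F x),
       Y_map F f u =
       Phi (restrict (mu_degrees mu d) V) (fac_obj F) (fac_B F) (fac_A F) x y f u)
  /\
  (forall V : rep k D, generated_in_degrees V d ->
   forall F : factorization E d V,
     exists Y_rep : functorial (@Y_map k D mu E l d V F), rep_iso V (Rep Y_rep)).
Proof.
split; last by move=> V genV F; apply: Y_map_iso.
exists (@Y_map_sub k D mu E l d) => V _ F x y f u; exact: Y_map_restrict.
Qed.
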